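(* Let $0<s\leq 1$. Let $I\subseteq(0,\infty)$ be an interval, let $f:I\to\mathbb{R}$ be a GA-$s$-convex function in the second sense on $I$, and let $a,b\in I$ with $a<b$. If $f\in L[a,b]$, then $$2^{s-1}f\left(\sqrt{ab}\right)\leq \frac{1}{\ln b-\ln a}\int_a^b\frac{f(x)}{x}\,dx\leq \frac{f(a)+f(b)}{s+1}.$$
   Context: Let $0<s\le 1$. A function $f:I\subseteq[0,\infty)\to\mathbb{R}$ is GA-$s$-convex in the second sense on $I$ if $f(x^t y^{1-t})\leq t^s f(x)+(1-t)^s f(y)$ for all $x,y\in I$ and all $t\in[0,1]$ (with $0^s=0$). $L[a,b]$ denotes the set of (Lebesgue) integrable functions on $[a,b]$. *)

(* Defs.v *)
From HB Require Import structures.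
From mathcomp Require Import all_boot all_order all_algebra.
From mathcomp Require Import all_classical all_reals all_analysis.
Set Implicit Arguments.
Unset Strict Implicit.
Unset Printing Implicit Defensive.
Import Order.TTheory GRing.Theory Num.Theory.
Import numFieldNormedType.Exports.
Local Open Scope classical_set_scope.
Local Open Scope ring_scope.

(* A function f : I -> R is represented by a total f : R -> R of which only the
   values on I matter; [powR] satisfies 0 `^ s = 0 for s != 0. *)
Definition GA_s_convex2 (R : realType) (s : R) (I : set R) (f : R -> R) : Prop :=
  forall x y t : R, I x -> I y -> 0 <= t <= 1 ->
    f (x `^ t * y `^ (1 - t)) <= t `^ s * f x + (1 - t) `^ s * f y.

(* Main.v *)
Require Import Defs.
From HB Require Import structures.
From mathcomp Require Import all_boot all_order all_algebra.
From mathcomp Require Import all_classical all_reals all_analysis.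
From mathcomp Require Import measurable_realfun.
From mathcomp Require Import ring lra.
Set Implicit Arguments.
Unset Strict Implicit.
Unset Printing Implicit Defensive.
Import Order.TTheory GRing.Theory Num.Theory.
Import numFieldNormedType.Exports.
Local Open Scope classical_set_scope.
Local Open Scope ring_scope.

(** Along the curve u |-> a^(1-u) b^u the statement becomes one about ordinary
    s-convexity.  Put L = ln b - ln a and h u = f (a^(1-u) b^u).  Then h is
    s-convex on [0, 1] and the substitution x = a^(1-u) b^u turns the mean of
    f x / x over [a, b] into the integral of h over [0, 1], so that the claim is
    the Hermite-Hadamard inequality for h.  The upper bound integrates
    h u <= u^s h 1 + (1-u)^s h 0, and the lower bound integrates
    2^s h (1/2) <= h u + h (1-u).

    Substituting in the integral of a function known only to be Lebesgue
    measurable would require transporting null sets.  This is avoided because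
    an s-convex function is continuous in the interior of its domain
    ([s_convex2_continuous]).  Hence f is Borel on [a, b], its integral for the
    completed measure is the one for the Borel measure
    ([integral_completed_lebesgue]), and the fundamental theorem of calculus
    makes H u = L^-1 * int_a^(a^(1-u) b^u) f t / t dt an antiderivative of h on
    ]0, 1[ that is continuous on [0, 1] ([geo_path_antiderivative]).  At 0 and 1,
    where h may be discontinuous, continuity of H is all that is available.

    The Hermite-Hadamard inequality is then proved for the increment H 1 - H 0
    of such an antiderivative ([s_convex2_hermite_hadamard]), where both bounds
    are monotonicity statements: a function with nonpositive derivative
    decreases. *)

(** * Completed versus Borel Lebesgue integral *)

Lemma measurable_id_completed (R : realType) :
  @measurable_fun _ _ _ _ setT
    (id : caratheodory_type (mu_ext (@wlength R idfun)) -> measurableTypeR R).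
Proof. by move=> _ A mA; rewrite setTI preimage_id; exact: sub_caratheodory. Qed.

(** The Borel measure is the image of the completed one under the identity,
    which is measurable from the larger sigma-algebra to the smaller one. *)
Lemma ge0_integral_completed_lebesgue (R : realType) (D : set (measurableTypeR R))
    (g : R -> \bar R) :
  measurable D ->
  measurable_fun D g -> (forall x, D x -> 0 <= g x)%E ->
  (\int[@completed_lebesgue_measure R]_(x in D) g x =
  \int[@lebesgue_measure R]_(x in D) g x)%E.
Proof.
move=> mD mg g0.
have := @ge0_integral_pushforward _ _ _ _ _ _ (@measurable_id_completed R)
  (@completed_lebesgue_measure R) D g mD mg.
move=> <-; last by move=> x; rewrite inE; exact: g0.
(* both measures are the same outer measure, on different sigma-algebras *)
exact: erefl.
Qed.

Lemma integral_completed_lebesgue (R : realType) (D : set (measurableTypeR R))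
    (g : R -> \bar R) :
  measurable D ->
  measurable_fun D g ->
  (\int[@completed_lebesgue_measure R]_(x in D) g x =
  \int[@lebesgue_measure R]_(x in D) g x)%E.
Proof.
move=> mD mg; rewrite integralE [RHS]integralE.
rewrite !ge0_integral_completed_lebesgue//.
- exact: measurable_funeneg.
- exact: measurable_funepos.
Qed.

Lemma integrable_completed_lebesgue (R : realType) (D : set (measurableTypeR R))
    (g : R -> \bar R) :
  measurable D ->
  measurable_fun D g ->
  (@completed_lebesgue_measure R).-integrable D g ->
  (@lebesgue_measure R).-integrable D g.
Proof.
move=> mD mg /integrableP[_ goo]; apply/integrableP; split => //.
by rewrite -integral_completed_lebesgue//; exact: measurableT_comp.
Qed.

(** * Continuity of powers *)

Lemma within_continuous_comp_sub (T U V : topologicalType) (A : set T)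
    (B : set U) (f : T -> U) (g : U -> V) :
  f @` A `<=` B -> {within A, continuous f} -> {within B, continuous g} ->
  {within A, continuous (g \o f)}.
Proof.
move=> fAB /subspace_continuousP cf /subspace_continuousP cg.
apply/subspace_continuousP => x Ax.
have Bfx : B (f x) by apply: fAB; exists x.
apply: cvg_comp (cg _ Bfx) => W BW.
have near_fW : \forall z \near x, A z -> B (f z) -> W (f z) by exact: (cf x Ax _ BW).
by apply: filterS near_fW => z + Az; apply => //; apply: fAB; exists z.
Qed.

(** [powR] takes the value 1 at negative bases, so it is discontinuous at 0; the
    absolute value restores continuity there. *)
Lemma continuous_powR_norm (R : realType) (p : R) : 0 < p ->
  continuous (fun x : R => `|x| `^ p).
Proof.
move=> p0 x; have [->|x0] := eqVneq x 0.
  rewrite /continuous_at normr0 powR0 ?gt_eqF//.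
  apply/cvgr0Pnorm_lt => e e0.
  near=> y; rewrite ger0_norm ?powR_ge0//.
  have -> : e = (e `^ p^-1) `^ p by rewrite -powRrM mulVf ?gt_eqF// powRr1// ltW.
  rewrite gt0_ltr_powR// ?nnegrE ?powR_ge0//.
  near: y; exists (e `^ p^-1) => /= [|z]; first exact: powR_gt0.
  by rewrite /ball_/= sub0r normrN.
have n0 : 0 < `|x| by rewrite normr_gt0.
have cp : {for `|x|, continuous (@powR R ^~ p)}.
  apply/differentiable_continuous/derivable1_diffP.
  by have [] := is_derive1_powR p n0.
exact: (cvg_comp _ _ (@norm_continuous R R x) cp).
Unshelve. all: by end_near. Qed.

Lemma within_continuous_powR (R : realType) (p : R) : 0 < p ->
  {within `[0, 1], continuous (@powR R ^~ p)}.
Proof.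
move=> p0; apply: (@subspace_eq_continuous _ _ _ (fun x : R => `|x| `^ p)).
  by move=> x; rewrite inE/= in_itv/= => /andP[x0 _]; rewrite ger0_norm.
by apply: continuous_subspaceT; exact: continuous_powR_norm.
Qed.

(** * s-convex functions *)

Definition s_convex2 (R : realType) (s : R) (A : set R) (h : R -> R) : Prop :=
  forall x y t : R, A x -> A y -> 0 <= t <= 1 ->
    h (t * x + (1 - t) * y) <= t `^ s * h x + (1 - t) `^ s * h y.

(** Choose r > 0 with z - r and z + r in [a, b], and let d = |y - z| < r.  Then y
    lies between z and one of z - r, z + r, with weight d / r on the latter, and
    z lies between y and the other one, with weight d / (r + d) on the latter.
    The two convexity inequalities squeeze h y between bounds that tend to h z
    as d tends to 0, because 0 < s makes d^s tend to 0. *)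
Lemma s_convex2_continuous (R : realType) (s a b : R) (h : R -> R) :
  0 < s -> s_convex2 s `[a, b] h -> {in `]a, b[, continuous h}.
Proof.
move=> s0 hconv z; rewrite in_itv/= => /andP[az zb].
pose r := Num.min (z - a) (b - z).
have r0 : 0 < r by rewrite /r lt_min !subr_gt0 az zb.
have raz : r <= z - a by rewrite /r ge_min lexx.
have rzb : r <= b - z by rewrite /r ge_min lexx orbT.
pose M := `|h (z - r)| + `|h (z + r)|.
have hM x : x \in [:: z - r; z + r] -> h x <= M.
  rewrite !inE => /orP[] /eqP ->.
    by apply: (le_trans (ler_norm _)); rewrite lerDl.
  by apply: (le_trans (ler_norm _)); rewrite lerDr.
pose d y := `|y - z|.
pose up y := (`|d y / r| `^ s) * M + (`|1 - d y / r| `^ s) * h z.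
pose lo y := (h z - (`|d y / (r + d y)| `^ s) * M) / `|1 - d y / (r + d y)| `^ s.
have bounds y : d y < r -> lo y <= h y <= up y.
  move=> dyr.
  have d0 : 0 <= d y by exact: normr_ge0.
  have rd0 : 0 < r + d y by rewrite ltr_pwDl.
  have t01 : 0 <= d y / r <= 1.
    by rewrite divr_ge0 ?(ltW r0)//= ler_pdivrMr// mul1r ltW.
  have u01 : 0 <= d y / (r + d y) <= 1.
    by rewrite divr_ge0 ?(ltW rd0)//= ler_pdivrMr// mul1r lerDr ltW.
  have u1 : 0 < 1 - d y / (r + d y).
    by rewrite subr_gt0 ltr_pdivrMr// mul1r ltrDr.
  (* e = 1 or -1 is the side of z on which y lies *)
  have [e [e1 ye]] : exists e, e ^+ 2 = 1 /\ y = z + e * d y.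
    rewrite /d; have [|] := leP 0 (y - z) => h0; [exists 1|exists (-1)].
      by split; [rewrite expr1n|rewrite ger0_norm//; ring].
    by split; [rewrite sqrrN expr1n|rewrite ltr0_norm//; ring].
  have e11 : (e == 1) || (e == -1) by rewrite -eqf_sqr e1 expr1n.
  have hzr t : t = e \/ t = - e -> h (z + t * r) <= M /\ `[a, b]%classic (z + t * r).
    move=> te.
    have {te} /orP[] : (t == 1) || (t == -1).
      by case: te => ->; rewrite ?eqr_oppLR ?opprK// orbC.
    - move=> /eqP ->; rewrite mul1r; split; first by apply: hM; rewrite !inE eqxx orbT.
      rewrite /= in_itv/=; lra.
    - move=> /eqP ->; rewrite mulN1r; split; first by apply: hM; rewrite !inE eqxx.
      rewrite /= in_itv/=; lra.
  have yab : `[a, b]%classic y.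
    move: dyr; rewrite /= in_itv/= /d ltr_norml; lra.
  have zab : `[a, b]%classic z by rewrite /= in_itv/= !ltW.
  rewrite /lo /up (ger0_norm (andP t01).1) (ger0_norm (andP u01).1).
  rewrite (ger0_norm (ltW u1)) ger0_norm ?subr_ge0 ?(andP t01).2//.
  have [hp pab] := hzr e (or_introl erefl).
  have [hm mab] := hzr (- e) (or_intror erefl).
  apply/andP; split.
    rewrite ler_pdivrMr ?powR_gt0// lerBlDl [h y * _]mulrC.
    have := hconv _ _ _ mab yab u01.
    have -> : d y / (r + d y) * (z + - e * r) + (1 - d y / (r + d y)) * y = z.
      by rewrite [X in _ + _ * X = _]ye; field; rewrite gt_eqF.
    move=> /le_trans; apply; rewrite lerD2r.
    by rewrite ler_wpM2l// powR_ge0.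
  have := hconv _ _ _ pab zab t01.
  have -> : d y / r * (z + e * r) + (1 - d y / r) * z = y.
    by rewrite [RHS]ye; field; rewrite gt_eqF.
  by move=> /le_trans; apply; rewrite lerD2r ler_wpM2l// powR_ge0.
have cd : d y @[y --> z] --> (0 : R).
  rewrite -[X in _ --> X](_ : d z = 0); last by rewrite /d subrr normr0.
  apply: cvg_norm; apply: cvgB; [exact: cvg_id|exact: cvg_cst].
have cpow (u : R -> R) l : u y @[y --> z] --> l -> `|u y| `^ s @[y --> z] --> `|l| `^ s.
  by move=> ul; exact: (cvg_comp _ _ ul (@continuous_powR_norm _ _ s0 l)).
have cq (v : R -> R) : v y @[y --> z] --> r -> d y / v y @[y --> z] --> (0 : R).
  move=> vr; rewrite -(mul0r r^-1); apply: cvgM => //.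
  by apply: cvgV => //; rewrite gt_eqF.
have ct0 : d y / r @[y --> z] --> (0 : R) by exact: (cq _ (cvg_cst _)).
have cu0 : d y / (r + d y) @[y --> z] --> (0 : R).
  by apply: cq; rewrite -[X in _ --> X]addr0; apply: cvgD => //; exact: cvg_cst.
have c1 (u : R -> R) : u y @[y --> z] --> (0 : R) -> `|1 - u y| `^ s @[y --> z] --> (1 : R).
  move=> u0; rewrite -[X in _ --> X](_ : `|1 - 0 : R| `^ s = 1); last first.
    by rewrite subr0 normr1 powR1.
  by apply: cpow; apply: cvgB => //; exact: cvg_cst.
have c0 (u : R -> R) : u y @[y --> z] --> (0 : R) -> `|u y| `^ s @[y --> z] --> (0 : R).
  by move=> /cpow; rewrite normr0 powR0// gt_eqF.
apply: (@squeeze_cvgr _ _ _ _ lo up).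
- near=> y; apply: bounds.
  by near: y; apply: (cvgr_lt _ cd).
- rewrite -[X in _ --> X](_ : (h z - 0 * M) / 1 = h z); last by rewrite mul0r subr0 divr1.
  apply: cvgM; last by apply: cvgV; [rewrite oner_eq0|exact: c1].
  apply: cvgB; first exact: cvg_cst.
  by apply: cvgM; [exact: c0|exact: cvg_cst].
- rewrite -[X in _ --> X](_ : 0 * M + 1 * h z = h z); last by rewrite mul0r add0r mul1r.
  by apply: cvgD; apply: cvgM; [exact: c0|exact: cvg_cst|exact: c1|exact: cvg_cst].
Unshelve. all: by end_near. Qed.

(** H stands for an antiderivative of h, required to be continuous but not
    derivable at 0 and 1.  For the lower bound, u |-> H (1 - u) - H u + C u with
    C = 2^s h (1/2) decreases on [0, 1/2], its derivative being
    C - h u - h (1 - u).  For the upper bound, H decreases on [0, 1] once an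
    antiderivative of u^s h 1 + (1 - u)^s h 0 is subtracted from it. *)
Lemma s_convex2_hermite_hadamard (R : realType) (s : R) (h H : R -> R) :
  0 < s -> s_convex2 s `[0, 1] h ->
  {within `[0, 1], continuous H} ->
  (forall u : R, u \in `]0, 1[ -> is_derive u 1 H (h u)) ->
  2 `^ (s - 1) * h 2^-1 <= H 1 - H 0 <= (h 0 + h 1) / (s + 1).
Proof.
move=> s0 hconv cH dH.
have cflip A : {within A, continuous (fun u : R => 1 - u)}.
  by apply: continuous_subspaceT => u; apply: cvgB; [exact: cvg_cst|exact: cvg_id].
have dflip (u : R) : is_derive u 1 (fun u : R => 1 - u) (-1).
  by apply: is_derive_eq; rewrite add0r mul1r.
have flip01 : (fun u : R => 1 - u) @` `[0, 1] `<=` `[0, 1].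
  by move=> _ [u + <-]; rewrite /= !in_itv/=; lra.
have s1 : 0 < s + 1 by lra.
apply/andP; split.
- pose C := 2 `^ s * h 2^-1.
  pose K u := H (1 - u) - H u + C * u.
  have hC (u : R) : 0 <= u <= 1 -> C <= h u + h (1 - u).
    move=> u01.
    have uI : `[0, 1]%classic u by [].
    have vI : `[0, 1]%classic (1 - u) by rewrite /= in_itv/=; lra.
    have hI : 0 <= (2^-1 : R) <= 1 by lra.
    have := hconv _ _ _ uI vI hI.
    have -> : 2^-1 * u + (1 - 2^-1) * (1 - u) = 2^-1 :> R by field.
    have -> : 1 - 2^-1 = 2^-1 :> R by field.
    rewrite -mulrDr -(ler_pM2l (powR_gt0 s (ltr0Sn R 1))) mulrA -powRM ?invr_ge0//.
    have -> : 2 * 2^-1 = 1 :> R by rewrite divff// pnatr_eq0.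
    by rewrite powR1 !mul1r.
  have dK (u : R) : u \in `]0, 2^-1[ -> is_derive u 1 K (- h (1 - u) - h u + C).
    rewrite in_itv/= => u01.
    have ? : is_derive u 1 H (h u) by apply: dH; rewrite in_itv/=; lra.
    have ? : is_derive (1 - u) 1 H (h (1 - u)) by apply: dH; rewrite in_itv/=; lra.
    have ? := dflip u.
    by rewrite /K; apply: is_derive_eq; rewrite mulrN1 -[C *: _]/(C * _) mulr1.
  have cK : {within `[0, 1], continuous K}.
    have cC : {within `[0, 1], continuous (fun u : R => C * u)}.
      by apply: continuous_subspaceT => u; apply: cvgM; [exact: cvg_cst|exact: cvg_id].
    move=> u; apply: cvgD; last exact: cC.
    apply: cvgB; last exact: cH.
    exact: (within_continuous_comp_sub flip01 (cflip _) cH).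
  have : K 2^-1 <= K 0.
    apply: (@ler0_derive1_le_cc _ K 0 2^-1).
    + by move=> u /dK[].
    + move=> u u01; rewrite derive1E; have [_ ->] := dK _ u01.
      have := hC u; move: u01; rewrite in_itv/=; lra.
    + apply: continuous_subspaceW cK => u /=; rewrite !in_itv/=; lra.
    + by rewrite in_itv/=; lra.
    + by rewrite in_itv/=; lra.
    + lra.
  rewrite /K subr0 mulr0 addr0.
  have -> : 1 - 2^-1 = 2^-1 :> R by field.
  rewrite subrr add0r => /(le_trans _); apply.
  by rewrite powRB ?pnatr_eq0 ?implybT// powRr1// /C; lra.
- pose P (u : R) := (u `^ (s + 1) * h 1 - (1 - u) `^ (s + 1) * h 0) / (s + 1).
  pose D u := H u - P u.
  have dD (u : R) : u \in `]0, 1[ ->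
      is_derive u 1 D (h u - (u `^ s * h 1 + (1 - u) `^ s * h 0)).
    move=> u01; have ? := dH _ u01; move: u01; rewrite in_itv/= => u01.
    have u0 : 0 < u by lra.
    have u1 : 0 < 1 - u by lra.
    have ? := is_derive1_powR (s + 1) u0.
    have ? := is_derive1_powR (s + 1) u1.
    have ? := dflip u.
    (* the shape on which the derivation rules are found by inference *)
    have -> : D = H - (s + 1)^-1 *: (h 1 *: (@powR R ^~ (s + 1))
        - h 0 *: ((@powR R ^~ (s + 1)) \o (fun u : R => 1 - u))).
      apply/funext => v. rewrite /D /P !fctE /= /GRing.scale /=; ring.
    apply: is_derive_eq; rewrite addrK /GRing.scale /=.
    by field; rewrite gt_eqF.
  have : D 1 <= D 0.
    apply: (@ler0_derive1_le_cc _ D 0 1).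
    + by move=> u /dD[].
    + move=> u u01; rewrite derive1E; have [_ ->] := dD _ u01.
      move: u01; rewrite in_itv/= => u01.
      have := hconv 1 0 u.
      rewrite /= !in_itv/= mulr1 mulr0 addr0 subr_le0; apply; lra.
    + move=> u; apply: cvgB; first exact: cH.
      apply: cvgM; last exact: cvg_cst.
      apply: cvgB; (apply: cvgM; last exact: cvg_cst).
        exact: within_continuous_powR.
      exact: (within_continuous_comp_sub flip01 (cflip _) (within_continuous_powR s1)).
    + by rewrite in_itv/=; lra.
    + by rewrite in_itv/=; lra.
    + lra.
  rewrite /D /P subr0 subrr powR0 ?gt_eqF// powR1 !mul0r !mul1r.
  lra.
Qed.

(** * Geometric interpolation between two positive numbers *)

(** For positive a and b this is a^(1-u) b^u; the exponential form makes it
    manifestly smooth in u and affine in logarithmic coordinates. *)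
Definition geo_path (R : realType) (a b u : R) : R :=
  expR (ln a + u * (ln b - ln a)).

Section geo_path.
Variables (R : realType) (a b : R).
Hypotheses (a0 : 0 < a) (ab : a < b).

Let b0 : 0 < b. Proof. exact: lt_trans ab. Qed.
Let L0 : 0 < ln b - ln a. Proof. by rewrite subr_gt0 ltr_ln. Qed.

Lemma geo_path_gt0 u : 0 < geo_path a b u. Proof. exact: expR_gt0. Qed.

Lemma geo_path0 : geo_path a b 0 = a.
Proof. by rewrite /geo_path mul0r addr0 lnK. Qed.

Lemma geo_path1 : geo_path a b 1 = b.
Proof. by rewrite /geo_path mul1r addrC subrK lnK. Qed.

Lemma geo_path_half : geo_path a b 2^-1 = Num.sqrt (a * b).
Proof.
rewrite -powR12_sqrt ?mulr_ge0 ?ltW// /powR gt_eqF ?mulr_gt0//.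
by rewrite lnM//; congr expR; field.
Qed.

Lemma geo_path_conv x y t : geo_path a b (t * x + (1 - t) * y) =
  geo_path a b x `^ t * geo_path a b y `^ (1 - t).
Proof. by rewrite /geo_path -!expRM -expRD; congr expR; ring. Qed.

Lemma geo_path_mono : {mono geo_path a b : u v / u <= v}.
Proof. by move=> u v; rewrite ler_expR lerD2l ler_pM2r. Qed.

Lemma geo_path_cc u : 0 <= u <= 1 -> a <= geo_path a b u <= b.
Proof.
move=> /andP[u0 u1]; have := geo_path_mono 0 u; rewrite geo_path0 u0 => ->.
by have := geo_path_mono u 1; rewrite geo_path1 u1 => ->.
Qed.

Lemma geo_path_oo u : 0 < u < 1 -> a < geo_path a b u < b.
Proof.
move=> /andP[u0 u1]; have lt_mono := leW_mono geo_path_mono.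
have := lt_mono 0 u; rewrite geo_path0 u0 => ->.
by have := lt_mono u 1; rewrite geo_path1 u1 => ->.
Qed.

Lemma geo_path_ln x : 0 < x -> geo_path a b ((ln x - ln a) / (ln b - ln a)) = x.
Proof.
by move=> x0; rewrite /geo_path divfK ?gt_eqF// addrC subrK lnK.
Qed.

Lemma is_derive_geo_path (u : R) :
  is_derive u 1 (geo_path a b) (geo_path a b u * (ln b - ln a)).
Proof.
have ? : is_derive u 1 (fun v : R => ln a + v * (ln b - ln a)) (ln b - ln a).
  by apply: is_derive_eq; rewrite add0r mul1r scaler0 add0r /GRing.scale/= mulr1.
exact: (@is_derive1_comp _ expR (fun v : R => ln a + v * (ln b - ln a)) u).
Qed.

Lemma GA_s_convex2_geo_path s (I : set R) (f : R -> R) :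
  is_interval I -> I a -> I b -> GA_s_convex2 s I f ->
  s_convex2 s `[0, 1] (f \o geo_path a b).
Proof.
move=> I_itv Ia Ib fconv x y t; rewrite /= => x01 y01 t01.
have geoI u : u \in `[0, 1] -> I (geo_path a b u).
  by rewrite in_itv/= => u01; apply: (I_itv _ _ Ia Ib); exact: geo_path_cc.
by rewrite geo_path_conv; apply: fconv => //; exact: geoI.
Qed.

End geo_path.

(** * The logarithmic change of variable *)

(** By the fundamental theorem of calculus G x = int_a^x f t / t dt has derivative
    f x / x at each x in ]a, b[, and composing G with the interpolation, whose
    speed at x is x (ln b - ln a), cancels the weight 1 / x. *)
Lemma geo_path_antiderivative (R : realType) (a b : R) (f : R -> R) :
  0 < a -> a < b -> {in `]0, 1[, continuous (f \o geo_path a b)} ->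
  (@completed_lebesgue_measure R).-integrable `[a, b] (EFin \o f) ->
  exists H : R -> R,
    [/\ {within `[0, 1], continuous H},
        forall u : R, u \in `]0, 1[ -> is_derive u 1 H ((f \o geo_path a b) u) &
        H 1 - H 0 = (ln b - ln a)^-1 *
          \int[@completed_lebesgue_measure R]_(x in `[a, b]) (f x / x)].
Proof.
move=> a0 ab ch f_int.
have b0 : 0 < b := lt_trans a0 ab.
have L0 : 0 < ln b - ln a by rewrite subr_gt0 ltr_ln.
pose g x := f x / x.
have cg : {in `]a, b[, continuous g}.
  move=> x; rewrite in_itv/= => /andP[ax xb].
  have x0 : 0 < x := lt_trans a0 ax.
  apply: cvgM; last by apply: cvgV; [rewrite gt_eqF|exact: cvg_id].
  (* near x, f is f o geo_path composed with the logarithmic coordinate u *)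
  pose u y := (ln y - ln a) / (ln b - ln a).
  have ux01 : u x \in `]0, 1[.
    rewrite in_itv/= /u divr_gt0 ?subr_gt0 ?ltr_ln//=.
    by rewrite ltr_pdivrMr// mul1r ltrD2r ltr_ln.
  have cu : u y @[y --> x] --> u x.
    apply: cvgM; last exact: cvg_cst.
    by apply: cvgB; [exact: continuous_ln|exact: cvg_cst].
  have := cvg_comp _ _ cu (ch _ ux01).
  rewrite /= geo_path_ln//; apply: cvg_trans; apply: near_eq_cvg.
  near=> y; rewrite /= geo_path_ln//.
  by near: y; exact: lt_nbhsr.
have mg : measurable_fun (`[a, b]%classic : set (measurableTypeR R)) g.
  (* false and true encode the endpoints of the open interval *)
  apply: (@measurable_fun_itv_cc _ a b false true).
  apply: open_continuous_measurable_fun; first exact: interval_open.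
  by move=> x; rewrite inE; exact: cg.
have mab : measurable (`[a, b]%classic : set (measurableTypeR R)) by exact: measurable_itv.
have mEg : measurable_fun (`[a, b]%classic : set (measurableTypeR R)) (EFin \o g).
  exact/measurable_EFinP.
have ig_completed : (@completed_lebesgue_measure R).-integrable `[a, b] (EFin \o g).
  have mab' : measurable (`[a, b]%classic :
      set (caratheodory_type (mu_ext (@wlength R idfun)))) by exact: sub_caratheodory.
  (* the weight 1 / x is at most 1 / a on [a, b] *)
  apply: le_integrable (integrableZl _ (a^-1) f_int) => //.
  - move=> _ A mA; apply: sub_caratheodory; exact: mEg.
  - move=> x; rewrite /= in_itv/= => /andP[ax xb].
    have x0 : 0 < x := lt_le_trans a0 ax.
    rewrite lee_fin /g !normrM mulrC ler_wpM2r//.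
    by rewrite !gtr0_norm ?invr_gt0// lef_pV2.
have ig := integrable_completed_lebesgue mab mEg ig_completed.
pose G x := parameterized_integral (@lebesgue_measure R) a x g.
exists (fun u => (ln b - ln a)^-1 * G (geo_path a b u)); split.
- have cG : {within `[a, b], continuous G}.
    exact: parameterized_integral_continuous (ltW ab) ig.
  have cgeo : {within `[0, 1], continuous (geo_path a b)}.
    apply: continuous_subspaceT => u.
    apply/differentiable_continuous/derivable1_diffP.
    by have [] := is_derive_geo_path a b u.
  have geoab : geo_path a b @` `[0, 1] `<=` `[a, b].
    move=> _ [u + <-]; rewrite /= !in_itv/= => u01; exact: geo_path_cc.
  move=> u; apply: cvgM; first exact: cvg_cst.
  exact: (within_continuous_comp_sub geoab cgeo cG).
- move=> u; rewrite in_itv/= => /(geo_path_oo a0 ab)/andP[ax xb].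
  have xab : geo_path a b u \in `]a, b[ by rewrite in_itv/= ax xb.
  have [dG G'] := continuous_FTC1_closed xb ig ax (cg _ xab).
  have GD : is_derive (geo_path a b u) 1 G (g (geo_path a b u)).
    by split => //; rewrite -derive1E.
  have ? := is_derive_geo_path a b u.
  have ? := is_derive1_comp GD _.
  have -> : (fun v => (ln b - ln a)^-1 * G (geo_path a b v)) =
    (ln b - ln a)^-1 *: (G \o geo_path a b) by [].
  apply: is_derive_eq; rewrite /GRing.scale/= /g.
  have := geo_path_gt0 a b u => ?.
  by field; rewrite !gt_eqF.
- rewrite geo_path1// geo_path0// -mulrBr /G /parameterized_integral.
  by rewrite set_itv1 Rintegral_set1 subr0 /Rintegral integral_completed_lebesgue.
Unshelve. all: by end_near. Qed.

(** * Hermite-Hadamard inequality for GA-s-convex functions *)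

Theorem theorem7 (R : realType) (s : R) (hs : 0 < s <= 1)
    (I : set R) (I_itv : is_interval I) (I_pos : I `<=` `]0, +oo[)
    (f : R -> R) (f_conv : GA_s_convex2 s I f)
    (a b : R) (Ia : I a) (Ib : I b) (ltab : a < b)
    (f_int : (@completed_lebesgue_measure R).-integrable `[a, b] (EFin \o f)) :
  2 `^ (s - 1) * f (Num.sqrt (a * b))
    <= (ln b - ln a)^-1 * (\int[@completed_lebesgue_measure R]_(x in `[a, b]) (f x / x))
  /\ (ln b - ln a)^-1 * (\int[@completed_lebesgue_measure R]_(x in `[a, b]) (f x / x))
    <= (f a + f b) / (s + 1).
Proof.
have /andP[s0 _] := hs.
have a0 : 0 < a by have := I_pos _ Ia; rewrite /= in_itv/= andbT.
have h_conv := GA_s_convex2_geo_path a0 ltab I_itv Ia Ib f_conv.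
have h_cont := s_convex2_continuous s0 h_conv.
have [H [cH dH <-]] := geo_path_antiderivative a0 ltab h_cont f_int.
have /andP[] := s_convex2_hermite_hadamard s0 h_conv cH dH.
by rewrite /= geo_path_half// geo_path0// geo_path1.
Qed.
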